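(* Let $I\subset\mathbb{R}$ be a bounded interval and $(W_n)_{n\ge1}$ a sequence of graphons from $\mathcal{W}_I$. If for all integers $q\ge1$ and all $J\in\mathrm{Sym}_q$ the sequences $(\mathcal{E}^{1/q}(W_n,J))_{n\ge1}$ converge, then for all $q\ge1$, all $\mathbf{a}\in\mathrm{Pd}_q$ and all $J\in\mathrm{Sym}_q$ the sequences $(\mathcal{E}_{\mathbf{a}}(W_n,J))_{n\ge1}$ converge.
   Context: A graphon is a bounded measurable function $W:[0,1]^2\to\mathbb{R}$ with $W(x,y)=W(y,x)$; $\mathcal{W}_I$ is the set of graphons with values in the interval $I$. $\mathrm{Sym}_q$ is the set of symmetric $q\times q$ real matrices, $[q]=\{1,\dots,q\}$, and $\mathrm{Pd}_q$ is the set of probability distributions $\mathbf{a}=(a_1,\dots,a_q)$ on $[q]$. A $q$-fractional partition is a tuple $\rho=(\rho_1,\dots,\rho_q)$ of measurable functions $\rho_i:[0,1]\to[0,1]$ with $\sum_{i=1}^q\rho_i(x)=1$ for every $x\in[0,1]$. For a graphon $W$ and $J\in\mathrm{Sym}_q$ put $$\mathcal{E}_\rho(W,J)=-\sum_{i,j=1}^q J_{ij}\int_{[0,1]^2}\rho_i(x)\rho_j(y)W(x,y)\,dx\,dy .$$ For $\mathbf{a}\in\mathrm{Pd}_q$ let $\omega_{\mathbf{a}}$ be the set of $q$-fractional partitions $\rho$ with $\int_0^1\rho_i(x)\,dx=a_i$ for all $i\in[q]$; the microcanonical ground state energy is $\mathcal{E}_{\mathbf{a}}(W,J)=\min_{\rho\in\omega_{\mathbf{a}}}\mathcal{E}_\rho(W,J)$.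 For $0\le c\le 1/q$ let $A_c=\{\mathbf{a}\in\mathrm{Pd}_q: a_i\ge c,\ i=1,\dots,q\}$ and $\mathcal{E}^{c}(W,J)=\inf_{\mathbf{a}\in A_c}\mathcal{E}_{\mathbf{a}}(W,J)$. In particular $\mathcal{E}^{1/q}(W,J)=\mathcal{E}_{\mathbf{b}}(W,J)$ with $\mathbf{b}=(1/q,\dots,1/q)\in\mathrm{Pd}_q$. *)

(* Defs.v *)
From HB Require Import structures.
From mathcomp Require Import all_boot all_order all_algebra.
From mathcomp Require Import all_classical all_reals all_analysis.

Set Implicit Arguments.
Unset Strict Implicit.
Unset Printing Implicit Defensive.

Import Order.TTheory GRing.Theory Num.Theory.
Import numFieldNormedType.Exports.

Local Open Scope classical_set_scope.
Local Open Scope ring_scope.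

Section Graphons.
Context {R : realType}.

Local Notation leb := (@lebesgue_measure R).

Definition unit_interval : set R := `[0, 1]%classic.

Definition unit_square : set (R * R) := unit_interval `*` unit_interval.

(** Graphons and fractional partitions are represented by total functions on
    [R * R] and [R]; their values outside the unit square and the unit interval
    are unconstrained and never used.  Measurability is with respect to the
    Borel sets. *)
Definition graphon (W : R * R -> R) : Prop :=
  [/\ measurable_fun unit_square W,
      [bounded W z | z in unit_square]
    & forall x y, unit_interval x -> unit_interval y -> W (x, y) = W (y, x)].

Definition graphon_in (I : set R) (W : R * R -> R) : Prop :=
  graphon W /\ (forall z, unit_square z -> I (W z)).

Definition symmetric_mx (q : nat) (J : 'M[R]_q) : Prop := J^T = J.

Definition prob_dist (q : nat) (a : 'I_q -> R) : Prop :=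
  (forall i, 0 <= a i) /\ \sum_(i < q) a i = 1.

Definition fractional_partition (q : nat) (rho : 'I_q -> R -> R) : Prop :=
  [/\ forall i, measurable_fun unit_interval (rho i),
      forall i x, unit_interval x -> 0 <= rho i x <= 1
    & forall x, unit_interval x -> \sum_(i < q) rho i x = 1].

Definition energy (q : nat) (W : R * R -> R) (J : 'M[R]_q)
    (rho : 'I_q -> R -> R) : R :=
  - \sum_(i < q) \sum_(j < q)
      J i j * \int[(leb \x leb)%E]_(z in unit_square)
                (rho i z.1 * rho j z.2 * W z).

Definition omega (q : nat) (a : 'I_q -> R) : set ('I_q -> R -> R) :=
  [set rho | fractional_partition rho /\
     forall i, \int[leb]_(x in unit_interval) rho i x = a i].

(** The minimum over [omega a] is written as the real infimum of the set of
    energies, which is nonempty and bounded below when [W] is a graphon and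
    [a] is a probability distribution. *)
Definition microcanonical_energy (q : nat) (W : R * R -> R) (J : 'M[R]_q)
    (a : 'I_q -> R) : R :=
  inf [set energy W J rho | rho in omega a].

Definition dist_ge (q : nat) (c : R) : set ('I_q -> R) :=
  [set a | prob_dist a /\ forall i, c <= a i].

Definition lower_threshold_energy (q : nat) (c : R) (W : R * R -> R)
    (J : 'M[R]_q) : R :=
  inf [set microcanonical_energy W J a | a in @dist_ge q c].

End Graphons.

(* Main.v *)
Require Import Defs.
From HB Require Import structures.
From mathcomp Require Import all_boot all_order all_algebra.
From mathcomp Require Import all_classical all_reals all_analysis.
From mathcomp Require Import measurable_realfun ring lra.

Set Implicit Arguments.
Unset Strict Implicit.
Unset Printing Implicit Defensive.

Import Order.TTheory GRing.Theory Num.Theory.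
Import numFieldNormedType.Exports.

Local Open Scope classical_set_scope.
Local Open Scope ring_scope.

(** Why the theorem holds.

    A stochastic matrix [K] from [q] states to [p] states turns a fractional
    partition [rho] with masses [a] into [push K rho], with masses [a K].  The
    energy is bilinear in the partition, so this amounts to replacing the
    interaction matrix: the energy of [push K rho] for [J] is that of [rho] for
    [K J K^T] ([energy_push]).  Comparing two ground states thus becomes finite
    linear algebra, in two ways.

    Rational masses.  If [a] has masses [k_i / p] with [k_i > 0] and
    [sum k_i = p], split state [i] into [k_i] equal copies.  Splitting and
    merging are both stochastic, and merging after splitting is the identity, so
    the ground state energy at [a] equals the one at the uniform distribution on
    [p] states, for the matrix [J] blown up along the copies
    ([microcanonical_energy_blowup]).  The lower threshold [1/p] leaves only the
    uniform distribution, so the hypothesis says that these energies converge.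

    Arbitrary masses.  If [a] and [b] admit a coupling [P], moving mass along
    [P] changes the energy by at most a constant times the mass
    [1 - \tr P] that leaves its state
    ([microcanonical_energy_coupling]); the constant involves only bounds on [J]
    and on the graphon.  Rounding the multiples [m a_i] up produces a rational
    [b] with positive entries and [b >= t a], where [t] is close to [1]
    ([rational_approximation]); for such a pair the coupling that keeps [t a]
    in place is good enough ([microcanonical_energy_dist]).  Hence the sequence
    for [a] is a limit, uniform over the bounded family of graphons, of
    convergent sequences, and it converges ([cvg_uniform_approximation]). *)

(** * Integration on the unit interval and the unit square *)

Section Integrals.
Context d (T : measurableType d) (R : realType).
Variable mu : {measure set T -> \bar R}.
Variables (D : set T) (mD : measurable D).

Lemma integrable_le_cst (M : R) (f : T -> R) : (mu D < +oo)%E ->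
  measurable_fun D f -> (forall x, D x -> `|f x| <= M) ->
  mu.-integrable D (EFin \o f).
Proof.
move=> Dfin mf fM; apply: measurable_bounded_integrable => //.
exists M; split; first exact: num_real.
by move=> y My x Dx; apply: le_trans (fM x Dx) (ltW My).
Qed.

Lemma integrableZl_EFin (r : R) (f : T -> R) :
  mu.-integrable D (EFin \o f) ->
  mu.-integrable D (EFin \o (fun x => r * f x)).
Proof. by move=> fi; exact: (integrableZl mD r fi). Qed.

Lemma integrable_sum_EFin (I : Type) (s : seq I) (f : I -> T -> R) :
  (forall i, mu.-integrable D (EFin \o f i)) ->
  mu.-integrable D (EFin \o (fun x => \sum_(i <- s) f i x)).
Proof.
move=> fi; rewrite (_ : _ \o _ = (fun x => \sum_(i <- s) (f i x)%:E)%E).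
  by apply: integrable_sum => // i _; exact: fi.
by apply/funext => x /=; rewrite sumEFin.
Qed.

Lemma Rintegral_sum (I : Type) (s : seq I) (f : I -> T -> R) :
  (forall i, mu.-integrable D (EFin \o f i)) ->
  \int[mu]_(x in D) (\sum_(i <- s) f i x) =
  \sum_(i <- s) \int[mu]_(x in D) f i x.
Proof.
move=> fi; elim: s => [|i s IH].
  rewrite big_nil -[RHS](mul0r (fine (mu D))) -Rintegral_cst//.
  by apply: eq_Rintegral => x _; rewrite big_nil.
rewrite big_cons -IH -RintegralD//; last exact: integrable_sum_EFin.
by apply: eq_Rintegral => x _; rewrite big_cons.
Qed.

End Integrals.

Section UnitInterval.
Context {R : realType}.
Local Notation leb := (@lebesgue_measure R).
Local Notation U := (@unit_interval R).
Local Notation sq := (@unit_square R).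
Implicit Types f g : R -> R.

Lemma measurable_unit_interval : measurable U.
Proof. exact: measurable_itv. Qed.

Lemma measurable_unit_square : measurable sq.
Proof. by apply: measurableX; exact: measurable_unit_interval. Qed.

Lemma lebesgue_unit_interval : leb U = 1%E.
Proof.
by rewrite /unit_interval lebesgue_measure_itv /= lte_fin ltr01 oppr0 adde0.
Qed.

Lemma lebesgue_unit_square : (leb \x leb)%E sq = 1%E.
Proof.
rewrite product_measure1E; [|exact: measurable_unit_interval..].
rewrite -[RHS]mule1; congr (_ * _)%E; exact: lebesgue_unit_interval.
Qed.

Lemma measurable_fst_unit_square f :
  measurable_fun U f -> measurable_fun sq (f \o fst).
Proof.
move=> mf; apply: (measurable_comp (F := U)) => //.
- exact: measurable_unit_interval.
- by move=> _ [z [zU _] <-].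
- by apply: measurable_funTS; exact: measurable_fst.
Qed.

Lemma measurable_snd_unit_square f :
  measurable_fun U f -> measurable_fun sq (f \o snd).
Proof.
move=> mf; apply: (measurable_comp (F := U)) => //.
- exact: measurable_unit_interval.
- by move=> _ [z [_ zU] <-].
- by apply: measurable_funTS; exact: measurable_snd.
Qed.

Lemma integrable_unit_interval (M : R) f : measurable_fun U f ->
  (forall x, U x -> `|f x| <= M) -> leb.-integrable U (EFin \o f).
Proof.
move=> mf fM; apply: (@integrable_le_cst _ _ _ _ _ _ M) => //.
  exact: measurable_unit_interval.
by apply: (@le_lt_trans _ _ 1%E); rewrite ?ltry// -lebesgue_unit_interval.
Qed.

Lemma integrable_unit_square (M : R) (f : R * R -> R) : measurable_fun sq f ->
  (forall z, sq z -> `|f z| <= M) -> (leb \x leb)%E.-integrable sq (EFin \o f).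
Proof.
move=> mf fM; apply: (@integrable_le_cst _ _ _ _ _ _ M) => //.
  exact: measurable_unit_square.
by apply: (@le_lt_trans _ _ 1%E); rewrite ?ltry// -lebesgue_unit_square.
Qed.

(** Tonelli on the square is applied to the extensions of [f] and [g] by zero,
    whose product is the extension by zero of the integrand. *)
Lemma Rintegral_unit_square_prod f g :
  measurable_fun U f -> measurable_fun U g ->
  (forall x, U x -> 0 <= f x <= 1) -> (forall x, U x -> 0 <= g x <= 1) ->
  \int[(leb \x leb)%E]_(z in sq) (f z.1 * g z.2) =
  (\int[leb]_(x in U) f x) * \int[leb]_(x in U) g x.
Proof.
move=> mf mg f01 g01.
have mU := measurable_unit_interval.
have ext (h : R -> R) :
    measurable_fun U h -> (forall x, U x -> 0 <= h x <= 1) ->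
    [/\ measurable_fun setT (h \_ U), (forall x, 0 <= (h \_ U) x)
      & (\int[leb]_x ((h \_ U) x)%:E = (\int[leb]_(x in U) h x)%:E)%E].
  move=> mh h01; split.
  - exact/(measurable_restrictT _ mU).
  - by move=> x; rewrite patchE; case: ifPn => // /set_mem /h01 /andP[].
  - rewrite Rintegral_mkcond /Rintegral fineK//.
    apply: integrable_fin_num => //.
    have := @integrable_mkcond _ _ _ leb U (EFin \o h) mU.
    rewrite restrict_EFin => <-.
    apply: (@integrable_unit_interval 1) => // x /h01 /andP[h0 h1].
    by rewrite ger0_norm.
have [mF F0 iF] := ext f mf f01; have [mG G0 iG] := ext g mg g01.
rewrite Rintegral_mkcond /Rintegral.
rewrite (_ : (\int[_]_x _)%E =
  (\int[(leb \x leb)%E]_z ((f \_ U) z.1 * (g \_ U) z.2)%:E)%E); last first.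
  apply: eq_integral => -[x y] _ /=; congr EFin; rewrite !patchE in_setX /=.
  by case: (x \in U); case: (y \in U); rewrite /= ?mulr0 ?mul0r.
rewrite fubini_tonelli1 /=; last 2 first.
- apply/measurable_EFinP; apply: measurable_funM; exact: measurableT_comp.
- by move=> z; rewrite lee_fin mulr_ge0.
rewrite /fubini_F /=.
under eq_integral.
  move=> x _.
  under eq_integral do rewrite EFinM.
  rewrite ge0_integralZl; [|by []|exact/measurable_EFinP
    |by move=> y _; rewrite lee_fin|by rewrite lee_fin].
  rewrite iG.
  over.
rewrite ge0_integralZr//; last 3 first.
- exact/measurable_EFinP.
- by move=> x _; rewrite lee_fin.
- by rewrite lee_fin; apply: Rintegral_ge0 => x /g01 /andP[].
by rewrite iF.
Qed.

End UnitInterval.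

(** * Pushing fractional partitions along stochastic matrices *)

Section Kernels.
Context {R : realType}.
Local Notation leb := (@lebesgue_measure R).
Local Notation U := (@unit_interval R).
Local Notation sq := (@unit_square R).

Definition stochastic (q p : nat) (K : 'M[R]_(q, p)) : Prop :=
  (forall i j, 0 <= K i j) /\ (forall i, \sum_j K i j = 1).

Definition push (q p : nat) (K : 'M[R]_(q, p)) (rho : 'I_q -> R -> R) :
  'I_p -> R -> R := fun j x => \sum_i K i j * rho i x.

Definition overlap (W : R * R -> R) (f g : R -> R) : R :=
  \int[(leb \x leb)%E]_(z in sq) (f z.1 * g z.2 * W z).

Lemma fractional_partition_integrable (q : nat) (rho : 'I_q -> R -> R) i :
  fractional_partition rho -> leb.-integrable U (EFin \o rho i).
Proof.
move=> [mrho rho01 _]; apply: (@integrable_unit_interval _ 1) => // x Ux.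
by have /andP[r0 r1] := rho01 i x Ux; rewrite ger0_norm.
Qed.

Lemma push_fractional_partition (q p : nat) (K : 'M[R]_(q, p))
    (rho : 'I_q -> R -> R) :
  stochastic K -> fractional_partition rho -> fractional_partition (push K rho).
Proof.
move=> [K0 K1] [mrho rho01 rho1].
have sum1 x : U x -> \sum_j push K rho j x = 1.
  move=> Ux; rewrite exchange_big /= -(rho1 x Ux); apply: eq_bigr => i _.
  by rewrite -mulr_suml K1 mul1r.
have ge0 j x : U x -> 0 <= push K rho j x.
  move=> Ux; apply: sumr_ge0 => i _; rewrite mulr_ge0//.
  by have /andP[] := rho01 i x Ux.
split=> // [j|j x Ux].
- by apply: measurable_sum => i; exact: measurable_funM.
- rewrite ge0//= -(sum1 x Ux) (bigD1 j)//= lerDl.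
  by apply: sumr_ge0 => k _; exact: ge0.
Qed.

Lemma push_omega (q p : nat) (K : 'M[R]_(q, p)) (a : 'I_q -> R) (b : 'I_p -> R)
    (rho : 'I_q -> R -> R) :
  stochastic K -> (forall j, \sum_i a i * K i j = b j) ->
  omega a rho -> omega b (push K rho).
Proof.
move=> sK aK [fp arho]; split; first exact: push_fractional_partition.
have mU := @measurable_unit_interval R.
move=> j; rewrite -aK Rintegral_sum//; last first.
  move=> i; apply: integrableZl_EFin => //.
  exact: fractional_partition_integrable.
apply: eq_bigr => i _; rewrite RintegralZl// ?arho 1?mulrC//.
exact: fractional_partition_integrable.
Qed.

Section Energy.
Variables (M : R) (W : R * R -> R).
Hypothesis mW : measurable_fun sq W.
Hypothesis WM : forall z, sq z -> `|W z| <= M.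

Lemma overlap_integrable (f g : R -> R) :
  measurable_fun U f -> measurable_fun U g ->
  (forall x, U x -> 0 <= f x <= 1) -> (forall x, U x -> 0 <= g x <= 1) ->
  (leb \x leb)%E.-integrable sq (EFin \o (fun z => f z.1 * g z.2 * W z)).
Proof.
move=> mf mg f01 g01; apply: (@integrable_unit_square _ M).
  apply: measurable_funM => //; apply: measurable_funM.
  - exact: measurable_fst_unit_square.
  - exact: measurable_snd_unit_square.
move=> z sz; have [U1 U2] := sz.
have /andP[f0 f1] := f01 _ U1; have /andP[g0 g1] := g01 _ U2.
rewrite normrM ger0_norm ?mulr_ge0// -[leRHS]mul1r.
by rewrite ler_pM// ?mulr_ge0// ?WM// mulr_ile1.
Qed.

Lemma overlap_push (q p : nat) (K : 'M[R]_(q, p)) (rho : 'I_q -> R -> R) k l :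
  fractional_partition rho ->
  overlap W (push K rho k) (push K rho l) =
  \sum_i \sum_j K i k * K j l * overlap W (rho i) (rho j).
Proof.
move=> [mrho rho01 _]; have msq := @measurable_unit_square R.
have int i j : (leb \x leb)%E.-integrable sq
    (EFin \o (fun z => K i k * K j l * (rho i z.1 * rho j z.2 * W z))).
  apply: integrableZl_EFin => //.
  exact: (overlap_integrable (mrho i) (mrho j) (rho01 i) (rho01 j)).
rewrite /overlap.
transitivity (\int[(leb \x leb)%E]_(z in sq)
    (\sum_i \sum_j K i k * K j l * (rho i z.1 * rho j z.2 * W z))).
  apply: eq_Rintegral => z _; rewrite /push mulr_suml mulr_suml.
  apply: eq_bigr => i _; rewrite mulr_sumr mulr_suml.
  by apply: eq_bigr => j _; rewrite mulrACA -!mulrA.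
rewrite Rintegral_sum//; last by move=> i; exact: integrable_sum_EFin.
apply: eq_bigr => i _; rewrite Rintegral_sum//.
apply: eq_bigr => j _; rewrite RintegralZl//.
exact: (overlap_integrable (mrho i) (mrho j) (rho01 i) (rho01 j)).
Qed.

Lemma overlap_le (f g : R -> R) :
  measurable_fun U f -> measurable_fun U g ->
  (forall x, U x -> 0 <= f x <= 1) -> (forall x, U x -> 0 <= g x <= 1) ->
  `|overlap W f g| <=
    M * ((\int[leb]_(x in U) f x) * \int[leb]_(x in U) g x).
Proof.
move=> mf mg f01 g01; have msq := @measurable_unit_square R.
have iW := overlap_integrable mf mg f01 g01.
have int : (leb \x leb)%E.-integrable sq (EFin \o (fun z => f z.1 * g z.2)).
  apply: (@integrable_unit_square _ 1).
    apply: measurable_funM.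
    - exact: measurable_fst_unit_square.
    - exact: measurable_snd_unit_square.
  move=> z [/f01 /andP[f0 f1] /g01 /andP[g0 g1]].
  by rewrite ger0_norm ?mulr_ge0// mulr_ile1.
rewrite /overlap; apply: (le_trans (le_normr_Rintegral _ iW)) => //.
rewrite -Rintegral_unit_square_prod// -RintegralZl//.
apply: le_Rintegral => //.
- exact: integrable_norm.
- exact: integrableZl_EFin.
move=> z sz; have [/f01 /andP[f0 _] /g01 /andP[g0 _]] := sz.
by rewrite normrM ger0_norm ?mulr_ge0// mulrC ler_wpM2r ?mulr_ge0// WM.
Qed.

(** The factor [a i * a j], rather than a bound by [M] alone, is what makes the
    errors in [microcanonical_energy_coupling] add up to the mass that moves,
    even when the kernel moves most of a state of small mass. *)
Lemma overlap_omega_le (q : nat) (a : 'I_q -> R) (rho : 'I_q -> R -> R) i j :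
  omega a rho -> `|overlap W (rho i) (rho j)| <= M * (a i * a j).
Proof.
move=> [[mrho rho01 _] arho]; rewrite -!arho.
by apply: overlap_le => // x Ux; exact: rho01.
Qed.

Lemma energyE (q : nat) (J : 'M[R]_q) (rho : 'I_q -> R -> R) :
  energy W J rho = - \sum_i \sum_j J i j * overlap W (rho i) (rho j).
Proof. by []. Qed.

(** Splitting and merging states act on the interaction matrix alone; every
    comparison of ground state energies below rests on this identity. *)
Lemma energy_push (q p : nat) (K : 'M[R]_(q, p)) (J : 'M[R]_p)
    (rho : 'I_q -> R -> R) :
  fractional_partition rho ->
  energy W J (push K rho) = energy W (K *m J *m K^T) rho.
Proof.
move=> fp; rewrite !energyE; congr (- _).
transitivity (\sum_k \sum_l \sum_i \sum_j
    J k l * (K i k * K j l * overlap W (rho i) (rho j))).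
  apply: eq_bigr => k _; apply: eq_bigr => l _; rewrite overlap_push//.
  by rewrite mulr_sumr; apply: eq_bigr => i _; rewrite mulr_sumr.
under eq_bigr do rewrite exchange_big.
rewrite exchange_big /=; apply: eq_bigr => i _.
under eq_bigr do rewrite exchange_big.
rewrite exchange_big /=; apply: eq_bigr => j _.
rewrite exchange_big /= mxE mulr_suml; apply: eq_bigr => l _.
rewrite !mxE !mulr_suml; apply: eq_bigr => k _.
by rewrite !mulrA (mulrC (J k l)).
Qed.

End Energy.

End Kernels.

(** * Comparing ground state energies *)

Lemma sum_card_fibres (q p : nat) (phi : 'I_p -> 'I_q) :
  (\sum_i #|[pred u | phi u == i]|)%N = p.
Proof.
rewrite -[RHS]card_ord -sum1_card (partition_big phi predT)//=.
by apply: eq_bigr => i _; rewrite -sum1_card.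
Qed.

(** A probability vector that puts mass [K i i] on [i] averages [f] to a value
    near [f i]: only the remaining mass can shift it, each unit by at most
    [2 * N]. *)
Lemma stochastic_sum_dist (R : realType) (q : nat) (N : R) (K : 'M[R]_q)
    (f : 'I_q -> R) i :
  stochastic K -> (forall k, `|f k| <= N) ->
  `|\sum_k K i k * f k - f i| <= 2 * N * (1 - K i i).
Proof.
move=> [K0 K1] fN.
have Kii : 1 - K i i = \sum_(k | k != i) K i k.
  by rewrite -(K1 i) (bigD1 i)//= addrAC subrr add0r.
rewrite -[X in _ - X]mul1r -[X in X * f i](K1 i) mulr_suml -sumrB Kii mulr_sumr.
rewrite (bigD1 i)//= subrr add0r (le_trans (ler_norm_sum _ _ _))//.
apply: ler_sum => k _; rewrite -mulrBr normrM ger0_norm// mulrC ler_wpM2r//.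
by rewrite (le_trans (ler_normB _ _))// mulr2n mulrDl mul1r lerD.
Qed.

(** Averaging over rows and then over columns costs one use of
    [stochastic_sum_dist] each. *)
Lemma stochastic_conj_dist (R : realType) (q : nat) (N : R) (K J : 'M[R]_q)
    i j :
  stochastic K -> (forall k l, `|J k l| <= N) ->
  `|(K *m J *m K^T - J) i j| <= 2 * N * ((1 - K i i) + (1 - K j j)).
Proof.
move=> sK JN; pose g l := \sum_k K i k * J k l.
have gN l : `|g l| <= N.
  have [K0 K1] := sK; rewrite (le_trans (ler_norm_sum _ _ _))//.
  rewrite -[leRHS]mul1r -(K1 i) mulr_suml; apply: ler_sum => k _.
  by rewrite normrM ger0_norm// ler_wpM2l.
rewrite !mxE (_ : \sum__ _ = \sum_l K j l * g l); last first.
  by apply: eq_bigr => l _; rewrite !mxE mulrC.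
rewrite -(subrK (g j) (\sum__ _)) -addrA (le_trans (ler_normD _ _))//.
rewrite mulrDr [leRHS]addrC lerD//; first exact: stochastic_sum_dist.
exact: (stochastic_sum_dist (f := fun k => J k j)).
Qed.

Section Microcanonical.
Context {R : realType}.
Local Notation leb := (@lebesgue_measure R).
Local Notation U := (@unit_interval R).
Local Notation sq := (@unit_square R).

Lemma omega_nonempty (q : nat) (a : 'I_q -> R) : prob_dist a -> omega a !=set0.
Proof.
move=> [a0 a1]; exists (fun i _ => a i); split; last first.
  move=> i; rewrite Rintegral_cst; last exact: measurable_unit_interval.
  by rewrite [X in fine X]lebesgue_unit_interval mulr1.
split=> // i x _; rewrite a0/= -a1 (bigD1 i)//= lerDl.
exact: sumr_ge0.
Qed.

Variables (M : R) (W : R * R -> R).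
Hypothesis mW : measurable_fun sq W.
Hypothesis WM : forall z, sq z -> `|W z| <= M.

Lemma energy_has_lbound (q : nat) (J : 'M[R]_q) (a : 'I_q -> R) :
  has_lbound [set energy W J rho | rho in omega a].
Proof.
exists (- \sum_i \sum_j `|J i j| * (M * (a i * a j))) => _ [rho arho <-].
rewrite energyE lerN2; apply: ler_sum => i _; apply: ler_sum => j _.
rewrite (le_trans (ler_norm _))// normrM ler_wpM2l//.
exact: (overlap_omega_le mW WM).
Qed.

(** Transfers bounds from partitions to ground states: pushing the competitors
    for [a] produces competitors for [b]. *)
Lemma microcanonical_energy_push (q p : nat) (K : 'M[R]_(q, p)) (J : 'M[R]_q)
    (J' : 'M[R]_p) (a : 'I_q -> R) (b : 'I_p -> R) (e : R) :
  prob_dist a -> stochastic K -> (forall j, \sum_i a i * K i j = b j) ->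
  (forall rho, omega a rho ->
    energy W (K *m J' *m K^T) rho <= energy W J rho + e) ->
  microcanonical_energy W J' b <= microcanonical_energy W J a + e.
Proof.
move=> pa sK aK He; rewrite -lerBlDr; apply: lb_le_inf.
  by have [rho arho] := omega_nonempty pa; exists (energy W J rho), rho.
move=> _ [rho arho <-]; rewrite lerBlDr (le_trans _ (He rho arho))//.
rewrite -(energy_push mW WM); last by case: arho.
apply: ge_inf; first exact: energy_has_lbound.
by exists (push K rho) => //; exact: (push_omega sK aK).
Qed.

Definition coupling (q : nat) (a b : 'I_q -> R) (P : 'M[R]_q) : Prop :=
  [/\ forall i j, 0 <= P i j, forall i, \sum_j P i j = a i
    & forall j, \sum_i P i j = b j].

(** The transition kernel of [P] carries [a] to [b].  By
    [stochastic_conj_dist] and [overlap_omega_le] the energy changes by at most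
    the sum over [i] and [j] of
    [2 * N * M * a i * a j * ((1 - K i i) + (1 - K j j))], and the sum of
    [a i * (1 - K i i)] is the mass [1 - \tr P] of [P] off the diagonal. *)
Lemma microcanonical_energy_coupling (q : nat) (N : R) (J P : 'M[R]_q)
    (a b : 'I_q -> R) :
  prob_dist a -> coupling a b P -> (forall i j, `|J i j| <= N) ->
  microcanonical_energy W J b <=
    microcanonical_energy W J a + 4 * N * M * (1 - \tr P).
Proof.
move=> pa [P0 Pa Pb] JN; have [a0 a1] := pa.
(* Where [a i = 0] the row of [P] vanishes and any probability row will do. *)
pose K : 'M[R]_q :=
  \matrix_(i, j) if a i == 0 then (i == j)%:R else P i j / a i.
have aK i j : a i * K i j = P i j.
  rewrite mxE; case: eqP => [ai0|/eqP ai0]; last by rewrite mulrC divfK.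
  rewrite ai0 mul0r; apply/esym/eqP; rewrite eq_le P0 andbT.
  by rewrite -ai0 -Pa (bigD1 j)//= lerDl sumr_ge0.
have sK : stochastic K.
  split=> [i j|i]; first by rewrite mxE; case: ifP => // _; rewrite divr_ge0.
  have [ai0|ai0] := eqVneq (a i) 0.
    rewrite (bigD1 i)//= big1 => [|j ji]; rewrite mxE ai0 eqxx ?eqxx ?addr0//.
    by rewrite eq_sym (negPf ji).
  apply: (mulfI ai0); rewrite mulr_sumr mulr1 -[RHS]Pa.
  by apply: eq_bigr => j _; rewrite aK.
apply: (microcanonical_energy_push (K := K)) => //.
  by move=> j; rewrite -Pb; apply: eq_bigr => i _; rewrite aK.
move=> rho arho; rewrite -lerBlDl !energyE opprK addrC -sumrB.
apply: (@le_trans _ _ (\sum_i \sum_j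
    2 * N * ((1 - K i i) + (1 - K j j)) * (M * (a i * a j)))).
  apply: ler_sum => i _; rewrite -sumrB; apply: ler_sum => j _.
  rewrite -mulrBl (le_trans (ler_norm _))// normrM ler_pM//.
  - by have := stochastic_conj_dist i j sK JN; rewrite distrC !mxE.
  - exact: (overlap_omega_le mW WM).
have tr : \sum_i a i * (1 - K i i) = 1 - \tr P.
  by under eq_bigr do rewrite mulrBr mulr1 aK; rewrite sumrB a1.
rewrite (_ : 4 * N * M * _ = 2 * N * M *
    (\sum_i \sum_j a i * (1 - K i i) * a j +
     \sum_i \sum_j a i * (a j * (1 - K j j)))); last first.
  transitivity (2 * N * M * ((1 - \tr P) + (1 - \tr P))); first by ring.
  congr (_ * (_ + _)); first rewrite -tr.
    by apply: eq_bigr => i _; rewrite -mulr_sumr a1 mulr1.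
  transitivity (\sum_i a i * (1 - \tr P)); first by rewrite -mulr_suml a1 mul1r.
  by apply: eq_bigr => i _; rewrite -mulr_sumr tr.
rewrite -big_split mulr_sumr; apply: ler_sum => i _.
rewrite -big_split mulr_sumr; apply: ler_sum => j _ /=.
by rewrite le_eqVlt; apply/orP; left; apply/eqP; ring.
Qed.

(** The coupling leaves the common part [t * a] in place and distributes the
    remaining fraction [1 - t] of every state according to the excess
    [b - t * a], whose total mass is also [1 - t].  Its transpose is a coupling
    too, which gives the other inequality even where [a] vanishes. *)
Lemma microcanonical_energy_dist (q : nat) (N t : R) (J : 'M[R]_q)
    (a b : 'I_q -> R) :
  0 <= M -> 0 <= N -> (forall i j, `|J i j| <= N) ->
  prob_dist a -> prob_dist b -> 0 <= t <= 1 -> (forall i, t * a i <= b i) ->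
  `|microcanonical_energy W J a - microcanonical_energy W J b|
    <= 4 * N * M * (1 - t).
Proof.
move=> M0 N0 JN pa pb /andP[t0 t1] ab; have [a0 a1] := pa; have [b0 b1] := pb.
pose P : 'M[R]_q :=
  \matrix_(i, j) (t * a i * (i == j)%:R + a i * (b j - t * a j)).
have P0 i j : 0 <= P i j by rewrite mxE addr_ge0// !mulr_ge0// subr_ge0.
have diag i (f : 'I_q -> R) : \sum_j f j * (i == j)%:R = f i.
  rewrite (bigD1 i)//= eqxx mulr1 big1 ?addr0// => j ji.
  by rewrite eq_sym (negPf ji) mulr0.
have Pa i : \sum_j P i j = a i.
  under eq_bigr do rewrite mxE.
  rewrite big_split /= (diag i (fun=> t * a i)) -mulr_sumr sumrB -mulr_sumr.
  by rewrite a1 b1; ring.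
have Pb j : \sum_i P i j = b j.
  under eq_bigr do rewrite mxE eq_sym.
  by rewrite big_split /= (diag j (fun i => t * a i)) -mulr_suml a1; ring.
have trP : t <= \tr P.
  rewrite -[t]mulr1 -a1 mulr_sumr; apply: ler_sum => i _.
  by rewrite mxE eqxx mulr1 lerDl mulr_ge0// subr_ge0.
have cP : coupling a b P by [].
have cPT : coupling b a P^T.
  split=> [i j|i|j]; first by rewrite mxE.
  - by rewrite -Pb; apply: eq_bigr => k _; rewrite mxE.
  - by rewrite -Pa; apply: eq_bigr => k _; rewrite mxE.
have le1 := microcanonical_energy_coupling pa cP JN.
have le2 := microcanonical_energy_coupling pb cPT JN.
rewrite mxtrace_tr in le2.
have le3 : 4 * N * M * (1 - \tr P) <= 4 * N * M * (1 - t).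
  by rewrite ler_wpM2l ?mulr_ge0// lerB.
by rewrite ler_distlC; apply/andP; split; lra.
Qed.

(** [K] splits state [i] evenly among its preimages under [phi] and [L] merges
    them again.  The blown-up matrix is [L J L^T], and [K L = 1], so conjugating
    it by [K] gives back [J].  Every fibre must be nonempty for [K] to be
    stochastic. *)
Lemma microcanonical_energy_blowup (q p : nat) (phi : 'I_p -> 'I_q)
    (J : 'M[R]_q) :
  (0 < p)%N -> (forall i, 0 < #|[pred u | phi u == i]|)%N ->
  microcanonical_energy W J (fun i => #|[pred u | phi u == i]|%:R / p%:R) =
  microcanonical_energy W (\matrix_(u, v) J (phi u) (phi v))
    (fun=> p%:R^-1).
Proof.
move=> p0 phi0; set k := fun i => #|[pred u | phi u == i]|.
have p0R : p%:R != 0 :> R by rewrite pnatr_eq0 -lt0n.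
have k0R i : (k i)%:R != 0 :> R by rewrite pnatr_eq0 -lt0n phi0.
have kE i : \sum_u (phi u == i)%:R = (k i)%:R :> R.
  rewrite /k -sum1_card natr_sum [RHS]big_mkcond /=.
  by apply: eq_bigr => u _; rewrite inE; case: eqP.
have diag (u : 'I_p) (f : 'I_q -> R) : \sum_i (phi u == i)%:R * f i = f (phi u).
  rewrite (bigD1 (phi u))//= eqxx mul1r big1 ?addr0// => j ji.
  by rewrite eq_sym (negPf ji) mul0r.
have kp : \sum_i (k i)%:R = p%:R :> R.
  by rewrite -natr_sum sum_card_fibres.
pose L : 'M[R]_(p, q) := \matrix_(u, i) (phi u == i)%:R.
pose K : 'M[R]_(q, p) := \matrix_(i, u) ((phi u == i)%:R / (k i)%:R).
have sL : stochastic L.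
  split=> [u i|u]; first by rewrite mxE.
  rewrite -[RHS](diag u (fun=> 1)); apply: eq_bigr => i _.
  by rewrite mxE mulr1.
have sK : stochastic K.
  split=> [i u|i]; first by rewrite mxE divr_ge0.
  by under eq_bigr do rewrite mxE; rewrite -mulr_suml kE divff.
have KL : K *m L = 1%:M.
  apply/matrixP => i j; rewrite !mxE.
  transitivity (\sum_u (phi u == i)%:R * ((i == j)%:R / (k i)%:R) : R).
    apply: eq_bigr => u _; rewrite !mxE.
    case: eqP => [->|_]; last by rewrite !mul0r.
    by rewrite /= !mul1r mulrC.
  by rewrite -mulr_suml kE mulrC divfK.
have J'E : \matrix_(u, v) J (phi u) (phi v) = L *m J *m L^T.
  apply/matrixP => u v; rewrite !mxE -(diag v (fun j => J (phi u) j)).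
  apply: eq_bigr => j _; rewrite !mxE mulrC; congr (_ * _).
  by rewrite -(diag u (fun i => J i j)); apply: eq_bigr => i _; rewrite mxE.
apply/eqP; rewrite eq_le; apply/andP; split.
- rewrite -[leRHS]addr0; apply: (microcanonical_energy_push (K := L)) => //.
  + split=> [u|]; first by rewrite invr_ge0.
    by rewrite sumr_const card_ord -[RHS](mulVf p0R) mulr_natr.
  + by move=> i; rewrite -mulr_sumr mulrC -kE; congr (_ / _);
      apply: eq_bigr => u _; rewrite mxE.
  + by move=> rho _; rewrite addr0 J'E.
- rewrite -[leRHS]addr0; apply: (microcanonical_energy_push (K := K)) => //.
  + split=> [i|]; first by rewrite divr_ge0.
    by rewrite -mulr_suml kp divff.
  + move=> u; rewrite -[RHS](diag u (fun=> p%:R^-1)); apply: eq_bigr => i _.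
    by rewrite mxE mulrC -mulrA mulKf.
  + move=> rho _; rewrite addr0 J'E.
    rewrite (_ : K *m _ *m _ = J)// !mulmxA KL mul1mx -mulmxA -trmx_mul KL.
    by rewrite trmx1 mulmx1.
Qed.

End Microcanonical.

(** A probability distribution on [q] states with all masses at least [1/q] is
    uniform. *)
Lemma lower_threshold_energy_uniform (R : realType) (q : nat) (W : R * R -> R)
    (J : 'M[R]_q) :
  (0 < q)%N ->
  lower_threshold_energy q%:R^-1 W J =
  microcanonical_energy W J (fun=> q%:R^-1).
Proof.
move=> q0; have q0R : q%:R != 0 :> R by rewrite pnatr_eq0 -lt0n.
have sumq : \sum_(i < q) q%:R^-1 = 1 :> R.
  by rewrite sumr_const card_ord -[RHS](mulVf q0R) mulr_natr.
rewrite /lower_threshold_energy (_ : dist_ge _ = [set fun=> q%:R^-1]).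
  by rewrite image_set1 inf1.
apply/seteqP; split=> [a [[a0 a1] aq]|_ ->]; last by split=> //; split.
apply/funext => i; apply/eqP; rewrite -subr_eq0; apply/eqP.
have s0 : \sum_(i < q) (a i - q%:R^-1) = 0 by rewrite sumrB sumq a1 subrr.
by apply: (psumr_eq0P _ s0) => // j _; rewrite subr_ge0.
Qed.

(** * Rational approximation and convergence *)

(** The disjoint union of the ordinals ['I_(k i)], enumerated, projects to its
    index set with fibres of the prescribed sizes. *)
Lemma exists_fibres (q : nat) (k : 'I_q -> nat) :
  exists (p : nat) (phi : 'I_p -> 'I_q),
    p = (\sum_i k i)%N /\ forall i, #|[pred u | phi u == i]| = k i.
Proof.
pose T : finType := {i : 'I_q & 'I_(k i)}.
pose phi (u : 'I_#|T|) := tag (enum_val u).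
have phik i : #|[pred u | phi u == i]| = k i.
  transitivity (\sum_(x : T | tag x == i) 1)%N.
    rewrite -sum1_card (reindex (@enum_val T predT))//=.
    exact/onW_bij/enum_val_bij.
  rewrite (eq_bigl (fun x : T => (tag x == i) && true)); last first.
    by move=> x; rewrite andbT.
  rewrite -(@sig_big_dep _ _ _ _ _ (fun j => j == i) (fun _ _ => true)
    (fun _ _ => 1%N)).
  by rewrite big_pred1_eq sum1_card card_ord.
exists #|T|, phi; split=> //; rewrite -[LHS](sum_card_fibres phi).
by apply: eq_bigr => i _; exact: phik.
Qed.

(** With [k i] the least integer above [m * a i], the sum [p] of the [k i] lies
    between [m] and [m + q], and [t = m / p] works.  Taking the strict successor
    of the integer part keeps every fibre nonempty, also where [a i = 0]. *)
Lemma rational_approximation (R : realType) (q : nat) (a : 'I_q -> R) (e : R) :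
  (0 < q)%N -> prob_dist a -> 0 < e ->
  exists (p : nat) (phi : 'I_p -> 'I_q) (t : R),
    [/\ (0 < p)%N, forall i, (0 < #|[pred u | phi u == i]|)%N,
        0 <= t <= 1, 1 - t <= e
      & forall i, t * a i <= #|[pred u | phi u == i]|%:R / p%:R].
Proof.
move=> q0 [a0 a1] e0.
(* Since [1 - t = (p - m) / p <= q / m], any [m > q / e] is large enough. *)
pose m := (Num.truncn (q%:R / e)).+1.
have mqe : q%:R < e * m%:R by rewrite mulrC -ltr_pdivrMr// truncnS_gt.
pose k i := (Num.truncn (m%:R * a i)).+1.
have ma i : 0 <= m%:R * a i by rewrite mulr_ge0.
have km i : m%:R * a i <= (k i)%:R by rewrite ltW// truncnS_gt.
have mk i : (k i)%:R <= m%:R * a i + 1 by rewrite -natr1 lerD2r truncn_le.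
have [p [phi [pE phik]]] := exists_fibres k.
have mp : m%:R <= p%:R :> R.
  have -> : m%:R = \sum_i m%:R * a i by rewrite -mulr_sumr a1 mulr1.
  by rewrite pE natr_sum; apply: ler_sum => i _; exact: km.
have pm : p%:R <= m%:R + q%:R :> R.
  have -> : m%:R + q%:R = \sum_i (m%:R * a i + 1).
    by rewrite big_split -mulr_sumr a1 mulr1 sumr_const card_ord.
  by rewrite pE natr_sum; apply: ler_sum => i _; exact: mk.
have p0R : 0 < p%:R :> R by apply: lt_le_trans mp; rewrite ltr0n.
exists p, phi, (m%:R / p%:R); split.
- by rewrite -(ltr0n R).
- by move=> i; rewrite phik.
- by rewrite divr_ge0//= ler_pdivrMr// mul1r.
- rewrite -(ler_pM2r p0R) mulrBl divfK ?gt_eqF// mul1r.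
  have : e * m%:R <= e * p%:R by rewrite ler_wpM2l// ltW.
  lra.
- by move=> i; rewrite phik mulrAC ler_pM2r ?invr_gt0.
Qed.

Lemma cvg_uniform_approximation (R : realType) (f : nat -> R) :
  (forall e : R, 0 < e -> exists2 g : nat -> R,
    cvg (g @ \oo) & forall n, `|f n - g n| <= e) ->
  cvg (f @ \oo).
Proof.
move=> fg; apply/cauchy_cvgP/cauchy_exP => e e0.
have [|g /cvg_ex[/= l gl] gf] := fg (e / 2); first by rewrite divr_gt0.
exists l; have /cvgrPdist_lt/(_ (e / 2)) := gl.
rewrite divr_gt0// => /(_ isT); apply: filterS => n lg /=.
rewrite /ball /= -(subrKA (g n)) (le_lt_trans (ler_normD _ _))//.
by rewrite [e]splitr ltr_leD// distrC gf.
Qed.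

Theorem theorem2p1 (R : realType) (I : set R) (hI : is_interval I)
    (hbI : bounded_set I) (W : nat -> R * R -> R)
    (hW : forall n, graphon_in I (W n))
    (hcvg : forall (q : nat) (J : 'M[R]_q), (1 <= q)%N -> symmetric_mx J ->
       cvg ((fun n => lower_threshold_energy q%:R^-1 (W n) J) @ \oo)) :
  forall (q : nat) (a : 'I_q -> R) (J : 'M[R]_q),
    (1 <= q)%N -> prob_dist a -> symmetric_mx J ->
    cvg ((fun n => microcanonical_energy (W n) J a) @ \oo).
Proof.
move=> q a J q0 pa sJ.
have [M M0 IM] : exists2 M, 0 < M & forall x, I x -> `|x| <= M.
  have [M0 [_ HM]] := hbI; exists (`|M0| + 1); first by rewrite ltr_wpDl.
  by move=> x Ix; apply: HM => //; rewrite ltr_pwDr// ler_norm.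
have mW n : measurable_fun (@unit_square R) (W n) by have [[]] := hW n.
have WM n z : unit_square z -> `|W n z| <= M.
  by move=> sz; apply: IM; have [_] := hW n; apply.
(* The summand [1] only serves to make [N] positive. *)
pose N := 1 + \sum_i \sum_j `|J i j|.
have N0 : 0 < N by rewrite ltr_pwDl// sumr_ge0// => i _; exact: sumr_ge0.
have JN i j : `|J i j| <= N.
  rewrite /N (bigD1 i)//= (bigD1 j)//= addrCA -!addrA lerDl.
  have s0 : 0 <= \sum_(k | k != i) \sum_l `|J k l|.
    by apply: sumr_ge0 => k _; exact: sumr_ge0.
  by rewrite !addr_ge0// sumr_ge0.
apply: cvg_uniform_approximation => e e0.
have C0 : 0 < 4 * N * M by rewrite !mulr_gt0.
have [p [phi [t [p0 phi0 t01 te ta]]]] :=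
  rational_approximation q0 pa (divr_gt0 e0 C0).
pose b i : R := #|[pred u | phi u == i]|%:R / p%:R.
have pb : prob_dist b.
  split=> [i|]; first by rewrite divr_ge0.
  by rewrite -mulr_suml -natr_sum sum_card_fibres divff// pnatr_eq0 -lt0n.
exists (fun n => microcanonical_energy (W n) J b).
  under eq_fun.
    move=> n; rewrite (microcanonical_energy_blowup (mW n) (WM n))//.
    rewrite -lower_threshold_energy_uniform//.
  over.
  apply: hcvg => //; apply/matrixP => u v; rewrite !mxE.
  by rewrite -[in LHS]sJ mxE.
move=> n.
have := microcanonical_energy_dist (mW n) (WM n) (ltW M0) (ltW N0)
  JN pa pb t01 ta.
move=> /le_trans; apply.
by rewrite mulrC -ler_pdivlMr.
Qed.
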